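(* Let $n\ge 2$ be an integer and let $\mathcal{X}$ be a $3$-dimensional polyhedral Banach space (that is, $\mathbb{R}^3$ with a polyhedral norm) whose closed unit ball $B_{\mathcal{X}}$ is a right prism whose base is a regular polygon having $2n$ sides. Then $$\eta_{dw}(\mathcal{X})=\begin{cases}\sqrt{\sin^2\frac{\pi}{2n}+1}, & \text{when } n \text{ is odd},\\ \sqrt{\tan^2\frac{\pi}{2n}+1}, & \text{when } n \text{ is even}.\end{cases}$$
   Context: A finite-dimensional real Banach space is polyhedral if its closed unit ball has finitely many extreme points. A right prism is a polyhedron with two congruent parallel base polygons, one being the translate of the other in the direction orthogonal to the base planes. $\mathcal{L}(\mathcal{X})$ is the space of bounded linear operators on $\mathcal{X}$ with the operator norm, and $S_{\mathcal{L}(\mathcal{X})}$ is its unit sphere; $\mathcal{X}^*$ is the dual; $S_{\mathcal{X}}=\{x:\|x\|=1\}$. For $x\in S_{\mathcal{X}}$ put $\mathcal{J}(x)=\{f\in\mathcal{X}^*: f(x)=1=\|f\|\}$, and $\Pi=\{(x,f): x\in S_{\mathcal{X}}, f\in\mathcal{J}(x)\}$. The Davis-Wielandt radius of $T$ is $dw(T)=\sup\left\{\sqrt{|x^*(Tx)|^2+\|Tx\|^4}:(x,x^* )\in\Pi\right\}$ and the Davis-Wielandt index of $\mathcal{X}$ is $\eta_{dw}(\mathcal{X})=\inf\{dw(T):T\in S_{\mathcal{L}(\mathcal{X})}\}$. *)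

(* Defs.v *)
From mathcomp Require Import all_boot all_order all_algebra.
From mathcomp Require Import all_classical all_reals all_analysis.

Set Implicit Arguments.
Unset Strict Implicit.
Unset Printing Implicit Defensive.

Import Order.TTheory GRing.Theory Num.Theory.
Import numFieldNormedType.Exports.

Local Open Scope classical_set_scope.
Local Open Scope ring_scope.

Section Convexity.
Context {R : realType} {E : lmodType R}.
Implicit Types A : set E.

Definition conv_hull A : set E := smallest (@convex_set R E) A.

Definition extreme_points A : set E :=
  [set x | A x /\ forall y z (t : R), A y -> A z -> 0 < t -> t < 1 ->
     x = t *: y + (1 - t) *: z -> y = x /\ z = x].

End Convexity.

Section Euclidean.
Context {R : realType} {d : nat}.
Implicit Types (u v w c : 'rV[R]_d) (P Q : set 'rV[R]_d).

Definition dot u v : R := (u *m v^T) 0 0.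

(* m equally spaced points on the circle of centre c and radius r in the plane
   c + span (u, v), where (u, v) is orthonormal *)
Definition polygon_vertices (m : nat) c u v (r : R) : set 'rV[R]_d :=
  [set c + r *: (cos (k%:R * (2 * pi / m%:R)) *: u
               + sin (k%:R * (2 * pi / m%:R)) *: v) | k in [set k | (k < m)%N]].

Definition is_regular_polygon (m : nat) P : Prop :=
  (3 <= m)%N /\
  exists c u v (r : R),
    [/\ 0 < r, dot u u = 1, dot v v = 1, dot u v = 0
      & P = conv_hull (polygon_vertices m c u v r)].

(* Q is the polyhedron whose two bases are P and its translate P + w; the
   vector w is orthogonal to every direction q - p of the plane of P *)
Definition is_right_prism P Q : Prop :=
  exists w,
    [/\ w != 0,
        forall p q, P p -> P q -> dot (q - p) w = 0
      & Q = conv_hull (P `|` [set p + w | p in P])].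

End Euclidean.

Definition unit_ball {R : realType} (X : normedModType R) : set X :=
  [set x | `|x| <= 1].
Arguments unit_ball {R} X.

Section Operators.
Context {R : realType} {X Y : normedModType R}.

Definition bounded_op (T : {linear X -> Y}) : Prop :=
  bounded_near T (nbhs (0 : X)).

(* meaningful when T is bounded: sup is 0 on sets without an upper bound *)
Definition opnorm (T : {linear X -> Y}) : R :=
  sup [set `|T x| | x in unit_ball X].

End Operators.

Section DavisWielandt.
Context {R : realType}.

Definition polyhedral (X : normedModType R) : Prop :=
  finite_set (extreme_points (unit_ball X)).

Definition duality_set (X : normedModType R) (x : X) :
    set {linear X -> R^o} :=
  [set f : {linear X -> R^o} |
     [/\ bounded_op f, f x = 1 :> R & opnorm f = 1]].

Definition state_pairs (X : normedModType R) :
    set (X * {linear X -> R^o}) :=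
  [set p | `|p.1| = 1 /\ duality_set p.1 p.2].
Arguments state_pairs X : clear implicits.

Definition dw (X : normedModType R) (T : {linear X -> X}) : R :=
  sup [set Num.sqrt (`|p.2 (T p.1)| ^+ 2 + `|T p.1| ^+ 4)
      | p in state_pairs X].

Definition eta_dw (X : normedModType R) : R :=
  inf [set dw T | T in [set T : {linear X -> X} |
                          bounded_op T /\ opnorm T = 1]].

End DavisWielandt.

(* Main.v *)
Require Import Defs.
From HB Require Import structures.
From mathcomp Require Import all_boot all_order all_algebra.
From mathcomp Require Import all_classical all_reals all_analysis.
From mathcomp Require Import ring lra.

Import Order.TTheory GRing.Theory Num.Theory.
Import numFieldNormedType.Exports.

Local Open Scope classical_set_scope.
Local Open Scope ring_scope.

(** Write [delta] for [pi / 2n] and let [c] be [1] for even [n] and [cos delta]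
    for odd [n].  The index is [sqrt (s ^ 2 + 1)] with [s = c * tan delta], and
    [c] is the distance from the centre to the boundary of the polygon of
    circumradius one in the direction orthogonal to a vertex: for even [n] a
    quarter turn permutes the vertices, for odd [n] it sends each vertex towards
    the midpoint of a side.

    The unit ball is symmetric, and so is the prism about its centre because its
    base has an even number of sides; hence the centre is the origin
    ([prism_centre]).  In suitable coordinates the vertices of the ball are
    [(cos a, sin a, 1)] and [(cos a, sin a, -1)], where [a] runs over the vertex
    angles ([prism_frame_exists]).  A convex bound on the ball then only has to
    be checked at these points.

    Lower bound.  An operator [T] of norm one attains its norm at a vertex [v]
    of the prism ([norm_attained_at_vertex]).  The three faces through [v] give
    three states at [v].  If all three were smaller than [s] in modulus at the
    unit vector [y = T v], then the base component of [y] would be a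
    combination of [v] and of [c] times its quarter turn, both of norm at most
    one, with coefficients of total modulus less than one; since the height of
    [y] is also less than one, [y] would have norm less than one
    ([vertex_state_ge]).  So some state at [v] satisfies [s <= |f (T v)|] while
    [T v] has norm one.

    Upper bound.  The operator [T] is [c] times the quarter turn of the base,
    and zero on the axis.  It has norm one.  By Lumer's estimate
    ([state_numerical_bound]) its numerical radius is at most [s] as soon as
    [x + t T x] and [x - t T x] have norm at most [1 + t s] for one positive [t]
    and all [x] in the ball.  With [t c = tan delta] this holds because moving a
    vertex of the polygon by [tan delta] times its quarter turn gives
    [1 + tan delta ^ 2] times the midpoint of a side at that vertex
    ([norm_shifted_vertex]). *)

(** * Convex hulls *)

Section Hull.
Context {R : realType} {E : lmodType R}.
Implicit Types A C : set E.

Lemma convex_setP C :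
  convex_set C <->
  forall x y (t : R), 0 <= t -> t <= 1 -> C x -> C y ->
    C (t *: x + (1 - t) *: y).
Proof.
split=> [cC x y t t0 t1 /mem_set Cx /mem_set Cy|cC x y t /set_mem Cx /set_mem Cy].
  have t01 : Itv.spec (@Itv.num_sem R) (Itv.Real `[0%Z, 1%Z]) t.
    by apply/andP; split; rewrite ?num_real//= in_itv/= t0 t1.
  exact: (set_mem (cC x y (Itv.mk t01) Cx Cy)).
by apply: mem_set; apply: cC.
Qed.

Lemma conv_hull_sub A C : convex_set C -> A `<=` C -> conv_hull A `<=` C.
Proof. exact: smallest_sub. Qed.

Lemma sub_conv_hull A : A `<=` conv_hull A.
Proof. exact: sub_gen_smallest. Qed.

Lemma convex_conv_hull A : convex_set (conv_hull A).
Proof.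
apply/convex_setP => x y t t0 t1 Ax Ay C /= [cC AC].
by move/convex_setP: (cC); apply=> //; [exact: Ax|exact: Ay].
Qed.

End Hull.

Lemma linear_of {R : realType} (X Y : lmodType R) (f : X -> Y) :
  (forall a x y, f (a *: x + y) = a *: f x + f y) ->
  exists g : {linear X -> Y}, g =1 f.
Proof.
move=> lf; pose m := GRing.isLinear.Build R X Y *:%R f lf.
by exists (HB.pack_for {linear X -> Y} f m).
Qed.

Lemma convex_preimage {R : realType} {E F : lmodType R} (f : {linear E -> F})
    (a : F) (C : set F) :
  convex_set C -> convex_set [set x | C (a + f x)].
Proof.
move=> /convex_setP cC; apply/convex_setP => x y t t0 t1 /= Cx Cy.
have -> : a + f (t *: x + (1 - t) *: y)
    = t *: (a + f x) + (1 - t) *: (a + f y).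
  rewrite linearD !linearZ !scalerDr/= addrACA -scalerDl.
  by rewrite [t + _]addrC subrK scale1r.
exact: cC.
Qed.

Lemma convex_norm_le {R : realType} {X Y : normedModType R}
    (T : {linear X -> Y}) (M : R) : convex_set [set x | `|T x| <= M].
Proof.
apply/convex_setP => x y t t0 t1 /= Tx Ty.
rewrite linearD !linearZ (le_trans (ler_normD _ _))// !normrZ.
by rewrite !ger0_norm ?subr_ge0//; nra.
Qed.

Lemma ler_norm_comb {R : realType} {X : normedModType R} (s t : R) (x y : X) :
  `|s *: x + t *: y| <= `|s| * `|x| + `|t| * `|y|.
Proof. by rewrite (le_trans (ler_normD _ _))// !normrZ. Qed.

(** * Operator norms and states *)

Section OperatorNorm.
Context {R : realType} {X Y : normedModType R}.
Implicit Types T : {linear X -> Y}.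

Lemma unit_ball0 : unit_ball X 0.
Proof. by rewrite /unit_ball /= normr0. Qed.

Lemma bounded_op_ball T (M : R) :
  (forall x, unit_ball X x -> `|T x| <= M) -> bounded_op T.
Proof.
move=> TM; apply/ex_bound; exists M; apply/nbhs_norm0P; exists 1 => //= x /=.
by move=> /ltW /TM.
Qed.

Lemma opnorm_le T (M : R) :
  (forall x, unit_ball X x -> `|T x| <= M) -> opnorm T <= M.
Proof.
move=> TM; apply: ge_sup; first by exists `|T 0|, 0 => //; exact: unit_ball0.
by move=> _ [x xB <-]; exact: TM.
Qed.

Lemma le_opnorm_ball T x : bounded_op T -> unit_ball X x -> `|T x| <= opnorm T.
Proof.
move=> /bounded_funP/(_ 1)[M TM] xB; apply: ub_le_sup; last by exists x.
by exists M => _ [y yB <-]; exact: TM.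
Qed.

Lemma le_opnorm T x : bounded_op T -> `|T x| <= opnorm T * `|x|.
Proof.
move=> bT; have [->|x0] := eqVneq x 0; first by rewrite linear0 !normr0 mulr0.
have x_gt0 : 0 < `|x| by rewrite normr_gt0.
have := le_opnorm_ball T (`|x|^-1 *: x) bT.
rewrite linearZ normrZ normfV normr_id mulrC -ler_pdivrMr//; apply.
by rewrite /unit_ball /= normrZ normfV normr_id mulVf ?gt_eqF.
Qed.

Lemma ball_le1_norm_le T : (forall x, unit_ball X x -> `|T x| <= 1) ->
  forall z, `|T z| <= `|z|.
Proof.
move=> T1 z; have bT := bounded_op_ball T 1 T1.
by rewrite (le_trans (le_opnorm T z bT))// ler_piMl// opnorm_le.
Qed.

End OperatorNorm.

Section DavisWielandtBounds.
Context {R : realType} (X : normedModType R).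
Implicit Types (T : {linear X -> X}) (f : {linear X -> R^o}).

Lemma state_norm_le x f : state_pairs (x, f) -> forall z, `|f z| <= `|z|.
Proof.
by move=> [_ [bf _ f1]] z; rewrite (le_trans (le_opnorm _ z bf))//= f1 mul1r.
Qed.

Lemma opnorm1_le T : bounded_op T -> opnorm T = 1 -> forall z, `|T z| <= `|z|.
Proof. by move=> bT T1 z; rewrite (le_trans (le_opnorm _ z bT))// T1 mul1r. Qed.

Lemma state_pairsI x f : `|x| = 1 -> f x = 1 ->
  (forall z, unit_ball X z -> `|f z| <= 1) -> state_pairs (x, f).
Proof.
move=> x1 fx f1; split=> //=; split=> //; first exact: bounded_op_ball _ 1 f1.
apply/eqP; rewrite eq_le opnorm_le//=.
rewrite -[leLHS](normr1 R) -fx le_opnorm_ball//; first exact: bounded_op_ball _ 1 f1.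
by rewrite /unit_ball /= x1.
Qed.

Lemma dw_le T (s : R) : @state_pairs R X !=set0 -> bounded_op T -> opnorm T = 1 ->
  (forall x f, state_pairs (x, f) -> `|f (T x)| <= s) ->
  dw T <= Num.sqrt (s ^+ 2 + 1).
Proof.
move=> [p0 p0S] bT T1 Ts; apply: ge_sup.
  by exists (Num.sqrt (`|p0.2 (T p0.1)| ^+ 2 + `|T p0.1| ^+ 4)), p0.
move=> _ [[x f] xf <-] /=; apply: ler_wsqrtr; apply: lerD.
  by rewrite lerXn2r ?nnegrE//; [exact: le_trans (Ts x f xf)|exact: Ts].
rewrite exprn_ile1 ?normr_ge0//.
by rewrite (le_trans (opnorm1_le T bT T1 x))//; have [/= ->] := xf.
Qed.

Lemma dw_ge T (s : R) x f : bounded_op T -> opnorm T = 1 ->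
  state_pairs (x, f) -> `|T x| = 1 -> 0 <= s -> s <= `|f (T x)| ->
  Num.sqrt (s ^+ 2 + 1) <= dw T.
Proof.
move=> bT T1 xf Tx s0 sf.
apply: (@le_trans _ _ (Num.sqrt (`|f (T x)| ^+ 2 + `|T x| ^+ 4))).
  apply: ler_wsqrtr; rewrite Tx expr1n lerD2r.
  by rewrite lerXn2r ?nnegrE.
apply: ub_le_sup; last by exists (x, f).
exists (Num.sqrt (1 + 1)) => _ [[y g] yg <-] /=; apply: ler_wsqrtr.
have Ty : `|T y| <= 1 by rewrite (le_trans (opnorm1_le T bT T1 y))//; have [/= ->] := yg.
by rewrite lerD// exprn_ile1 ?normr_ge0// (le_trans (state_norm_le _ _ yg _)).
Qed.

(** The Lumer estimate: a state is a norm-one functional, so its value at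
    [x + t T x] is at most the norm of that vector, and subtracting
    [f x = 1] leaves [t f (T x)]. *)
Lemma state_numerical_bound T (t s : R) x f : state_pairs (x, f) -> 0 < t ->
  `|x + t *: T x| <= 1 + t * s -> `|x - t *: T x| <= 1 + t * s ->
  `|f (T x)| <= s.
Proof.
move=> xf t0 xp xm; have [_ /= [_ fx _]] := xf.
have fp := le_trans (ler_norm _) (le_trans (state_norm_le _ _ xf (x + t *: T x)) xp).
have fm := le_trans (ler_norm _) (le_trans (state_norm_le _ _ xf (x - t *: T x)) xm).
rewrite linearD linearZ /= fx in fp; rewrite linearB linearZ /= fx in fm.
have {}fp : f (T x) <= s by rewrite -(ler_pM2l t0) -(lerD2l 1).
have {}fm : - f (T x) <= s by rewrite -(ler_pM2l t0) -(lerD2l 1) mulrN.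
by rewrite ler_norml fp andbT lerNl.
Qed.

(** Both halves of the computation of the index use the same number [s]: any
    norm-one operator has a norm-attaining state at which [f (T x)] is at least
    [s], and one norm-one operator has numerical radius at most [s]. *)
Lemma eta_dw_eq (s : R) (T0 : {linear X -> X}) : 0 <= s ->
  bounded_op T0 -> opnorm T0 = 1 ->
  (forall x f, state_pairs (x, f) -> `|f (T0 x)| <= s) ->
  (forall T, bounded_op T -> opnorm T = 1 ->
     exists x f, [/\ state_pairs (x, f), `|T x| = 1 & s <= `|f (T x)|]) ->
  eta_dw X = Num.sqrt (s ^+ 2 + 1).
Proof.
move=> s0 bT0 T01 T0s low.
have lb : lbound [set dw T | T in [set T : {linear X -> X} |
    bounded_op T /\ opnorm T = 1]] (Num.sqrt (s ^+ 2 + 1)).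
  move=> _ [T [bT T1] <-]; have [x [f [xf Tx sf]]] := low T bT T1.
  exact: (dw_ge T s x f).
apply/eqP; rewrite eq_le lb_le_inf//; last by exists (dw T0), T0.
rewrite andbT; apply: (@le_trans _ _ (dw T0)).
  by apply: ge_inf; [exists (Num.sqrt (s ^+ 2 + 1))|exists T0].
apply: dw_le => //; have [x [f [xf _ _]]] := low T0 bT0 T01.
by exists (x, f).
Qed.

End DavisWielandtBounds.

(** * Angles of the regular polygon *)

Section Angles.
Context {R : realType} (n : nat) (hn : (2 <= n)%N).

Definition half_step : R := pi / (2 * n)%:R.

Local Notation delta := half_step.

Definition vertex_angle (k : nat) : R := k%:R * (2 * pi / (2 * n)%:R).

Lemma natr_n_gt0 : 0 < n%:R :> R.
Proof. by rewrite ltr0n; case: n hn. Qed.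

Lemma vertex_angleE k : vertex_angle k = k%:R * (2 * delta).
Proof. by rewrite /vertex_angle /half_step !mulrA. Qed.

Lemma n_half_step : n%:R * delta = pi / 2.
Proof.
have := natr_n_gt0 => n0.
by rewrite /half_step natrM; field; rewrite gt_eqF.
Qed.

Lemma half_step_gt0 : 0 < delta.
Proof. by rewrite /half_step divr_gt0 ?pi_gt0// ltr0n muln_gt0; case: n hn. Qed.

Lemma half_step_le : delta <= pi / 4.
Proof.
have n2 : 2 <= n%:R :> R by rewrite ler_nat.
have := n_half_step; have := half_step_gt0; nra.
Qed.

Lemma vertex_angleD j k : vertex_angle (j + k) = vertex_angle j + vertex_angle k.
Proof. by rewrite /vertex_angle natrD mulrDl. Qed.

Lemma vertex_angle1 : vertex_angle 1 = 2 * delta.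
Proof. by rewrite vertex_angleE mul1r. Qed.

Lemma vertex_angle_half : vertex_angle n = pi.
Proof. by rewrite vertex_angleE; have := n_half_step; lra. Qed.

Lemma vertex_angle_turns q : vertex_angle (q * (2 * n)) = pi *+ 2 *+ q.
Proof.
rewrite vertex_angleE !natrM -[RHS]mulr_natl -[pi *+ 2]mulr_natl -mulrA.
by congr (_ * _); have := n_half_step; lra.
Qed.

Lemma cos_vertex_angle_mod k x :
  cos (vertex_angle (k %% (2 * n)) + x) = cos (vertex_angle k + x).
Proof.
rewrite {2}(divn_eq k (2 * n)) vertex_angleD vertex_angle_turns.
by rewrite -addrA [_ *+ _ *+ _ + _]addrC (periodicn (@cosD2pi R)).
Qed.

Lemma sin_vertex_angle_mod k x :
  sin (vertex_angle (k %% (2 * n)) + x) = sin (vertex_angle k + x).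
Proof.
rewrite {2}(divn_eq k (2 * n)) vertex_angleD vertex_angle_turns.
by rewrite -addrA [_ *+ _ *+ _ + _]addrC (periodicn (@sinD2pi R)).
Qed.

Lemma cos_half_step_gt0 : 0 < cos delta.
Proof.
apply: cos_gt0_pihalf; have := pi_gt0 R.
by have := half_step_gt0; have := half_step_le; lra.
Qed.

Lemma sin_half_step_gt0 : 0 < sin delta.
Proof.
apply: sin_gt0_pihalf; have := pi_gt0 R.
by have := half_step_gt0; have := half_step_le; lra.
Qed.

Lemma tan_half_step_gt0 : 0 < tan delta.
Proof. by rewrite divr_gt0 ?cos_half_step_gt0 ?sin_half_step_gt0. Qed.

Lemma tan_half_step_le1 : tan delta <= 1.
Proof.
have pi0 := pi_gt0 R; rewrite -(@tan_piquarter R) leNgt ltr_tan ?in_itv/=.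
- by rewrite -leNgt half_step_le.
- by lra.
- by have := half_step_gt0; have := half_step_le; lra.
Qed.

(** Modulo full turns an odd multiple of [delta] lies between [delta] and
    [2 pi - delta]. *)
Lemma cos_odd_half_step k : cos (vertex_angle k + delta) <= cos delta.
Proof.
have pi0 := pi_gt0 R; have d0 := half_step_gt0; have d1 := half_step_le.
have n0 := natr_n_gt0; have nd := n_half_step.
rewrite -cos_vertex_angle_mod; have : (k %% (2 * n) < 2 * n)%N.
  by rewrite ltn_mod muln_gt0; case: n hn.
move: (k %% _)%N => {}k kn; rewrite vertex_angleE.
have {}kn : k%:R + 1 <= 2 * n%:R :> R by rewrite -natrM natr1 ler_nat.
have k0 : 0 <= k%:R :> R by [].
set x := k%:R * _ + delta.
have x1 : delta <= x by rewrite /x; nra.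
have x2 : x <= 2 * pi - delta by rewrite /x; nra.
have cos_le y : delta <= y -> y <= pi -> cos y <= cos delta.
  by move=> y1 y2; rewrite leNgt ltr_cos ?in_itv/= -?leNgt//; lra.
have [xpi|xpi] := leP x pi; first exact: cos_le.
rewrite -(cosN x) -(cosD2pi (- x)) -mulr_natl; apply: cos_le; lra.
Qed.

(** All vertices lie on one side of the line through two consecutive vertices;
    the unit normal of that line points at half a step from either of them. *)
Lemma cos_vertex_side j k (b : bool) :
  cos (vertex_angle j - (vertex_angle k + (-1) ^+ b * delta)) <= cos delta.
Proof.
have diff i l : cos (vertex_angle i - vertex_angle l + delta) <= cos delta.
  (* full turns keep the index [i - l] a natural number *)
  have := cos_odd_half_step (i + l * (2 * n) - l).
  have ll : (l <= i + l * (2 * n))%N.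
    by apply: leq_trans (leq_addl _ _); rewrite leq_pmulr// muln_gt0; case: n hn.
  suff -> : cos (vertex_angle (i + l * (2 * n) - l) + delta)
      = cos (vertex_angle i - vertex_angle l + delta) by [].
  rewrite -(periodicn (@cosD2pi R) l (_ - _ + _)) -vertex_angle_turns.
  have := vertex_angleD (i + l * (2 * n) - l) l; rewrite subnK// vertex_angleD.
  by move=> e; congr cos; lra.
case: b; rewrite ?expr0 ?expr1.
  by rewrite (_ : _ - _ = vertex_angle j - vertex_angle k + delta)//; lra.
rewrite -cosN.
by rewrite (_ : - _ = vertex_angle k - vertex_angle j + delta)//; lra.
Qed.

End Angles.

(** * Norms whose unit ball is a prism *)

Definition frame_comb {R : realType} {X : lmodType R} (U V W : X) (a b c : R) : X :=
  a *: U + b *: V + c *: W.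

(** [U], [V], [W] span the axes of the prism with [U] towards a vertex of the
    middle section and [W] half the height; [al], [be], [ga] are the dual
    coordinates.  [(-1) ^+ b] chooses one of the two bases. *)
Record prism_frame {R : realType} (X : normedModType R) (n : nat)
    (U V W : X) (al be ga : {linear X -> R^o}) : Prop := PrismFrame {
  frame_combE : forall x, x = frame_comb U V W (al x) (be x) (ga x);
  frame_coord : forall a b c, [/\ al (frame_comb U V W a b c) = a,
    be (frame_comb U V W a b c) = b & ga (frame_comb U V W a b c) = c];
  frame_vertex : forall k (b : bool), (k < 2 * n)%N ->
    `|frame_comb U V W (cos (vertex_angle n k)) (sin (vertex_angle n k))
        ((-1) ^+ b)| <= 1;
  frame_hull : forall C : set X, convex_set C ->
    (forall k (b : bool), (k < 2 * n)%N ->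
      C (frame_comb U V W (cos (vertex_angle n k)) (sin (vertex_angle n k))
           ((-1) ^+ b))) ->
    unit_ball X `<=` C }.

Section Prism.
Context {R : realType} (X : normedModType R) (n : nat) (hn : (2 <= n)%N).
Context (U V W : X) (al be ga : {linear X -> R^o}).
Context (frame : prism_frame X n U V W al be ga).

Local Notation fc := (frame_comb U V W).
Local Notation delta := (half_step n : R).
Local Notation ang := (@vertex_angle R n).
Local Notation vertex k b := (fc (cos (ang k)) (sin (ang k)) ((-1) ^+ nat_of_bool b)).

Lemma frame_combD a b c a' b' c' :
  fc a b c + fc a' b' c' = fc (a + a') (b + b') (c + c').
Proof.
by rewrite /frame_comb !scalerDl addrACA [X in X + _ = _]addrACA.
Qed.

Lemma frame_combZ k a b c : k *: fc a b c = fc (k * a) (k * b) (k * c).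
Proof. by rewrite /frame_comb !scalerDr !scalerA. Qed.

(** The norm is convex, so its maximum on a segment parallel to the axis is
    reached at an end. *)
Lemma norm_frame_comb_slide h M a b c : 0 < h ->
  `|fc a b h| <= M -> `|fc a b (- h)| <= M -> `|c| <= h -> `|fc a b c| <= M.
Proof.
move=> h0 ph mh; rewrite ler_norml => /andP[c1 c2].
have -> : fc a b c = ((h + c) / (2 * h)) *: fc a b h
                   + ((h - c) / (2 * h)) *: fc a b (- h).
  by rewrite !frame_combZ frame_combD; congr frame_comb; field; rewrite gt_eqF.
rewrite (le_trans (ler_norm_comb _ _ _ _))//.
have p1 : 0 <= (h + c) / (2 * h) by rewrite divr_ge0//; lra.
have p2 : 0 <= (h - c) / (2 * h) by rewrite divr_ge0//; lra.
rewrite (ger0_norm p1) (ger0_norm p2).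
have -> : M = (h + c) / (2 * h) * M + (h - c) / (2 * h) * M.
  by field; rewrite gt_eqF.
by rewrite lerD// ler_wpM2l.
Qed.

Lemma norm_vertex k b : `|vertex k b| <= 1.
Proof.
have := frame_vertex _ _ _ _ _ _ _ _ frame (k %% (2 * n)) b.
have e0 := cos_vertex_angle_mod (R := R) n hn k 0.
have e1 := sin_vertex_angle_mod (R := R) n hn k 0.
rewrite !addr0 in e0 e1; rewrite e0 e1; apply.
by rewrite ltn_mod muln_gt0; case: n hn.
Qed.

Lemma norm_height c : `|fc 0 0 c| <= `|c|.
Proof.
have -> : fc 0 0 c = (c / 2) *: vertex 0 false + (- c / 2) *: vertex 0 true.
  by rewrite !frame_combZ frame_combD; congr frame_comb; rewrite ?expr0 ?expr1; field.
rewrite (le_trans (ler_norm_comb _ _ _ _))//.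
have -> : `|- c / 2| = `|c / 2| by rewrite mulNr normrN.
have -> : `|c| = `|c / 2| + `|c / 2|.
  by rewrite normrM [`|2^-1|]ger0_norm ?invr_ge0//; field.
by rewrite lerD// ler_piMr// norm_vertex.
Qed.

Lemma ball_le_vertices {Y : normedModType R} (T : {linear X -> Y}) (M : R) :
  (forall k b, (k < 2 * n)%N -> `|T (vertex k b)| <= M) ->
  forall x, unit_ball X x -> `|T x| <= M.
Proof.
move=> TM; apply: (frame_hull _ _ _ _ _ _ _ _ frame [set x | `|T x| <= M]) => //.
exact: convex_norm_le.
Qed.

Lemma ball_functional_le (f : {linear X -> R^o}) :
  (forall k b, (k < 2 * n)%N -> f (vertex k b) <= 1) ->
  forall x, unit_ball X x -> `|f x| <= 1.
Proof.
move=> f1; have le1 : unit_ball X `<=` [set x | f x <= 1].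
  apply: (frame_hull _ _ _ _ _ _ _ _ frame) => //.
  apply/convex_setP => x y t t0 t1 /= fx fy.
  by rewrite linearD !linearZ /= -![_ *: _]/(_ * _); nra.
move=> x xB; rewrite ler_norml le1// andbT lerNl -linearN le1//.
by rewrite /unit_ball/= normrN.
Qed.

(** For [theta] half a step away from a vertex angle this is the norm-one
    functional equal to [1] on a lateral face: [cos delta] is the inradius of
    the polygon of circumradius one. *)
Definition side_functional (theta : R) : {linear X -> R^o} :=
  (cos delta)^-1 \*: (cos theta \*: al \+ sin theta \*: be).

Lemma side_functionalE theta a b c :
  side_functional theta (fc a b c) = (cos theta * a + sin theta * b) / cos delta.
Proof.
have [fa fb _] := frame_coord _ _ _ _ _ _ _ _ frame a b c.
by rewrite /side_functional /= fa fb mulrC.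
Qed.

Lemma side_functional_le k (b : bool) x : unit_ball X x ->
  `|side_functional (ang k + (-1) ^+ b * delta) x| <= 1.
Proof.
move: x; apply: ball_functional_le => j b' _.
rewrite side_functionalE ler_pdivrMr ?(cos_half_step_gt0 n hn)// mul1r.
by rewrite -cosB -cosN opprB; exact: cos_vertex_side.
Qed.

Lemma side_functional_vertex k (b b' : bool) :
  side_functional (ang k + (-1) ^+ b * delta) (vertex k b') = 1.
Proof.
rewrite side_functionalE -cosB addrC addKr.
rewrite (_ : cos _ = cos delta) ?divff ?gt_eqF ?(cos_half_step_gt0 n hn)//.
by case: b; rewrite ?expr0 ?expr1 ?mul1r ?mulN1r ?cosN.
Qed.

(** In the orthonormal frame of the base given by a vertex and its quarter turn,
    the functionals of the two lateral faces at that vertex differ only by the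
    sign of the second coordinate. *)
Lemma side_functional_neighbours k y (b : bool) :
  side_functional (ang k + (-1) ^+ b * delta) y
  = (cos (ang k) * al y + sin (ang k) * be y)
    + (-1) ^+ b * tan delta * (cos (ang k) * be y - sin (ang k) * al y).
Proof.
rewrite {1}[y](frame_combE _ _ _ _ _ _ _ _ frame) side_functionalE cosD sinD /tan.
have c0 : cos delta != 0 by rewrite gt_eqF ?cos_half_step_gt0.
by case: b; rewrite ?expr0 ?expr1 ?mul1r ?mulN1r ?cosN ?sinN; field.
Qed.

Lemma side_state k (b b' : bool) : state_pairs
  (vertex k b, side_functional (ang k + (-1) ^+ b' * delta)).
Proof.
apply: state_pairsI; last exact: side_functional_le.
  apply/eqP; rewrite eq_le norm_vertex/=.
  have := ball_le1_norm_le _ (side_functional_le k b') (vertex k b).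
  by rewrite side_functional_vertex normr1.
exact: side_functional_vertex.
Qed.

Lemma norm_vertexE k b : `|vertex k b| = 1.
Proof. by have [] := side_state k b true. Qed.

Definition height_functional (b : bool) : {linear X -> R^o} :=
  (-1) ^+ nat_of_bool b \*: ga.

Lemma height_state k b : state_pairs (vertex k b, height_functional b).
Proof.
have gE b' k' : ga (vertex k' b') = (-1) ^+ b'.
  by have [] := frame_coord _ _ _ _ _ _ _ _ frame
    (cos (ang k')) (sin (ang k')) ((-1) ^+ b').
apply: state_pairsI; first exact: norm_vertexE.
  by rewrite /= gE -[_ *: _]/(_ * _) -signr_addb addbb.
apply: ball_functional_le => k' b' _ /=; rewrite gE.
by rewrite -[_ *: _]/(_ * _) -signr_addb; case: (_ (+) _); rewrite ?expr0 ?expr1//; lra.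
Qed.

Lemma norm_attained_at_vertex (T : {linear X -> X}) : bounded_op T ->
  opnorm T = 1 -> exists k b, `|T (vertex k b)| = 1.
Proof.
move=> bT T1; apply/not_existsP => noatt.
have lt1 (p : 'I_(2 * n) * bool) : `|T (vertex p.1 p.2)| < 1.
  rewrite lt_neqAle; apply/andP; split.
    by apply/eqP => e; apply: (noatt p.1); exists p.2.
  by rewrite (le_trans (opnorm1_le _ T bT T1 _))// norm_vertexE.
pose M := \big[Num.max/0]_(p : 'I_(2 * n) * bool) `|T (vertex p.1 p.2)|.
have : M < 1 by apply: bigmax_lt.
rewrite ltNge => /negP; apply; rewrite -T1; apply: opnorm_le.
apply: ball_le_vertices => k b kn.
exact: (le_bigmax _ (fun p : 'I_(2 * n) * bool => `|T (vertex p.1 p.2)|)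
  (Ordinal kn, b)).
Qed.

Section QuarterTurn.
Context (c : R) (c0 : 0 < c) (c1 : c <= 1).
(* [c] times the quarter turn of the polygon stays in the polygon, and touches
   its boundary: the image of the vertex of angle zero lies on a side. *)
Context (turned_vertex : forall k (b : bool),
  `|fc (- (c * sin (ang k))) (c * cos (ang k)) ((-1) ^+ b)| <= 1).
Context (turned_on_side : exists j, c * sin (ang j + delta) = cos delta).

Let s := c * tan delta.

(** The base component of [y] has coordinates [a] along the vertex and [d] along
    its quarter turn.  Values below [s] at both side functionals mean
    [|a| + tan delta * |d| < s], a rhombus whose corners are [s] times the vertex
    and [c] times its quarter turn; as [s <= 1], the open rhombus
    lies inside the open ball. *)
Lemma vertex_state_ge k b y : `|y| = 1 ->
  exists f, state_pairs (vertex k b, f) /\ s <= `|f y|.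
Proof.
move=> y1; apply/not_existsP => nof.
have lts f : state_pairs (vertex k b, f) -> `|f y| < s.
  by move=> sf; rewrite ltNge; apply/negP => sfy; apply: (nof f).
have t0 : 0 < tan delta := tan_half_step_gt0 n hn.
have t1 : tan delta <= 1 := tan_half_step_le1 n hn.
have s0 : 0 < s by rewrite mulr_gt0.
have s1 : s <= 1 by rewrite mulr_ile1// ltW.
have fp := lts _ (side_state k b false).
have fm := lts _ (side_state k b true).
have fg := lts _ (height_state k b).
pose a := cos (ang k) * al y + sin (ang k) * be y.
pose d := cos (ang k) * be y - sin (ang k) * al y.
rewrite side_functional_neighbours -/a -/d expr0 mul1r in fp.
rewrite side_functional_neighbours -/a -/d expr1 mulN1r in fm.
have {}fg : `|ga y| < 1.
  by move: fg; rewrite /= normrM normrX normrN1 expr1n mul1r => /lt_le_trans; apply.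
have ad : `|a| + tan delta * `|d| < s.
  move: (a) (d) fp fm => x z.
  rewrite !ltr_norml => /andP[fp1 fp2] /andP[fm1 fm2].
  by case: (ger0P x) => ?; case: (ger0P z) => ?; lra.
pose e := `|a| + `|d| / c.
have e1 : e < 1.
  have a_le : s * `|a| <= `|a| by rewrite ler_piMl.
  rewrite -(ltr_pM2l s0) mulr1; apply: le_lt_trans ad.
  rewrite /e mulrDr lerD// /s.
  by rewrite (_ : c * tan delta * (`|d| / c) = tan delta * `|d|)//; field; rewrite gt_eqF.
(* any bound of [e] and [|ga y|] below one; [1 / 2] keeps it positive *)
pose l := Num.max (Num.max e `|ga y|) (1 / 2).
have l1 : l < 1 by rewrite !gt_max e1 fg; lra.
have l0 : 0 < l by rewrite !lt_max; apply/orP; right; lra.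
have el : e <= l by rewrite !le_max lexx.
have gl : `|ga y| <= l by rewrite !le_max lexx orbT.
have cs := cos2Dsin2 (ang k).
(* The heights [Num.sg a] and [Num.sg d] make the three terms add up to height
   [l], with norms [|a|], [|d| / c] and [l - e]. *)
have base_le h : `|h| = 1 -> `|fc (al y) (be y) (h * l)| <= l.
  move=> h1.
  have -> : fc (al y) (be y) (h * l)
      = a *: fc (cos (ang k)) (sin (ang k)) (h * Num.sg a)
      + (d / c) *: fc (- (c * sin (ang k))) (c * cos (ang k)) (h * Num.sg d)
      + fc 0 0 (h * (l - e)).
    have aa : a = cos (ang k) * al y + sin (ang k) * be y by [].
    have dd : d = cos (ang k) * be y - sin (ang k) * al y by [].
    have cn : c != 0 by rewrite gt_eqF.
    rewrite !frame_combZ !frame_combD; congr frame_comb.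
    - transitivity ((cos (ang k) ^+ 2 + sin (ang k) ^+ 2) * al y).
        by rewrite cs mul1r.
      by rewrite aa dd; field.
    - transitivity ((cos (ang k) ^+ 2 + sin (ang k) ^+ 2) * be y).
        by rewrite cs mul1r.
      by rewrite aa dd; field.
    - by rewrite /e (normrEsg a) (normrEsg d); field.
  have sg1 x : `|h * Num.sg x| <= 1.
    by rewrite normrM h1 mul1r normr_sg; case: (x != 0).
  rewrite (le_trans (ler_normD _ _))// -[leRHS](subrK e) addrC lerD//.
    rewrite (le_trans (norm_height _))// normrM h1 mul1r ger0_norm//.
    by rewrite subr_ge0.
  have na : `|fc (cos (ang k)) (sin (ang k)) (h * Num.sg a)| <= 1.
    apply: (norm_frame_comb_slide 1) => //.
      exact: (norm_vertex k false).
    exact: (norm_vertex k true).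
  have nd : `|fc (- (c * sin (ang k))) (c * cos (ang k)) (h * Num.sg d)| <= 1.
    apply: (norm_frame_comb_slide 1) => //.
      exact: (turned_vertex k false).
    exact: (turned_vertex k true).
  rewrite (le_trans (ler_norm_comb _ _ _ _))// lerD//; first by rewrite ler_piMr.
  by rewrite normrM [`|c^-1|]gtr0_norm ?invr_gt0// ler_piMr// divr_ge0// ltW.
have : `|y| <= l.
  rewrite [y](frame_combE _ _ _ _ _ _ _ _ frame).
  apply: (norm_frame_comb_slide l) => //.
    by rewrite -[l in X in X <= _]mul1r base_le// normr1.
  by rewrite -mulN1r base_le// normrN1.
by rewrite y1 leNgt l1.
Qed.

Lemma quarter_turn_exists : exists T : {linear X -> X},
  forall x, T x = fc (- (c * be x)) (c * al x) 0.
Proof.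
apply: linear_of => a x y; rewrite frame_combZ frame_combD.
rewrite !linearD !linearZ /= -![_ *: _]/(_ * _).
by congr frame_comb; ring.
Qed.

(** Moving a vertex [v] of the polygon by [tan delta] times its quarter turn
    reaches the direction of the midpoint of an adjacent side, at
    [1 + tan delta ^+ 2] times that midpoint.  This is why the operator has a
    small numerical radius. *)
Lemma norm_shifted_vertex k (b b' : bool) :
  `|fc (cos (ang k) - (-1) ^+ b' * tan delta * sin (ang k))
       (sin (ang k) + (-1) ^+ b' * tan delta * cos (ang k)) ((-1) ^+ b)|
  <= 1 + tan delta ^+ 2.
Proof.
(* the neighbour of vertex [k] before or after it, the former reached by going
   once around *)
pose k' := if b' then (k + (2 * n - 1))%N else k.+1.
have ck : (cos (ang k') = cos (ang k + (-1) ^+ b' * (2 * delta)))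
        * (sin (ang k') = sin (ang k + (-1) ^+ b' * (2 * delta))).
  rewrite /k'; case: b' {k'}; last first.
    by rewrite -addn1 vertex_angleD vertex_angle1 mul1r.
  rewrite -(cosD2pi (_ + _)) -(sinD2pi (_ + _)) expr1 mulN1r.
  suff -> : ang (k + (2 * n - 1)) = ang k - 2 * delta + pi *+ 2 by [].
  have := vertex_angleD n (k + (2 * n - 1)) 1 (R := R).
  rewrite vertex_angle1 -addnA subnK; last by rewrite muln_gt0; case: n hn.
  have := vertex_angle_turns n hn 1 (R := R); rewrite mul1n mulr1n => <-.
  by rewrite vertex_angleD; lra.
have cn : cos delta != 0 by rewrite gt_eqF ?cos_half_step_gt0.
have cs : sin delta ^+ 2 = 1 - cos delta ^+ 2 by rewrite -sin2cos2.
have sd : sin (2 * delta) = 2 * sin delta * cos delta.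
  by rewrite mulr_natl mulr2n sinD; ring.
have cd : cos (2 * delta) = 2 * cos delta ^+ 2 - 1.
  by rewrite mulr_natl mulr2n cosD -!expr2 cs; ring.
set t := tan delta; have t2 : 1 + t ^+ 2 = (cos delta ^+ 2)^-1 by rewrite -cos2_tan2.
have g0 : 0 < 1 + t ^+ 2 by have := sqr_ge0 t; lra.
have g1 : 1 <= 1 + t ^+ 2 by have := sqr_ge0 t; lra.
have -> : fc (cos (ang k) - (-1) ^+ b' * t * sin (ang k))
             (sin (ang k) + (-1) ^+ b' * t * cos (ang k)) ((-1) ^+ b)
  = (1 + t ^+ 2) *: fc ((cos (ang k) + cos (ang k')) / 2)
                       ((sin (ang k) + sin (ang k')) / 2)
                       ((-1) ^+ b / (1 + t ^+ 2)).
  have cb : cos ((-1) ^+ b' * (2 * delta)) = cos (2 * delta).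
    by case: b' {k' ck}; rewrite ?expr0 ?expr1 ?mul1r ?mulN1r ?cosN.
  have sb : sin ((-1) ^+ b' * (2 * delta)) = (-1) ^+ b' * sin (2 * delta).
    by case: b' {k' ck cb}; rewrite ?expr0 ?expr1 ?mul1r ?mulN1r ?sinN.
  rewrite frame_combZ !ck cosD sinD cb sb cd sd; congr frame_comb.
  - by rewrite t2 /t /tan; field.
  - by rewrite t2 /t /tan; field.
  - by rewrite mulrC divfK// gt_eqF.
rewrite normrZ gtr0_norm// ler_piMr ?(ltW g0)//.
have mid h : `|fc (cos (ang k)) (sin (ang k)) h| <= 1 ->
    `|fc (cos (ang k')) (sin (ang k')) h| <= 1 ->
    `|fc ((cos (ang k) + cos (ang k')) / 2) ((sin (ang k) + sin (ang k')) / 2) h|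
      <= 1.
  move=> h1 h2.
  have -> : fc ((cos (ang k) + cos (ang k')) / 2) ((sin (ang k) + sin (ang k')) / 2) h
    = 2^-1 *: fc (cos (ang k)) (sin (ang k)) h
    + 2^-1 *: fc (cos (ang k')) (sin (ang k')) h.
    by rewrite !frame_combZ frame_combD; congr frame_comb; field.
  rewrite (le_trans (ler_norm_comb _ _ _ _))// ger0_norm ?invr_ge0//; lra.
apply: (norm_frame_comb_slide 1) => //.
- by apply: mid; exact: (norm_vertex _ false).
- by apply: mid; exact: (norm_vertex _ true).
by rewrite normrM normrX normrN1 expr1n mul1r gtr0_norm ?invr_gt0// invf_le1.
Qed.

Theorem eta_dw_prism : eta_dw X = Num.sqrt ((c * tan delta) ^+ 2 + 1).
Proof.
have [T TE] := quarter_turn_exists.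
have t0 : 0 < tan delta := tan_half_step_gt0 n hn.
have Tfc a b d : T (fc a b d) = fc (- (c * b)) (c * a) 0.
  by have [fa fb _] := frame_coord _ _ _ _ _ _ _ _ frame a b d; rewrite TE fa fb.
have T_le x : unit_ball X x -> `|T x| <= 1.
  move: x; apply: ball_le_vertices => k b _; rewrite Tfc.
  apply: (norm_frame_comb_slide 1) => //; last by rewrite normr0.
    exact: (turned_vertex k false).
  exact: (turned_vertex k true).
have bT := bounded_op_ball T 1 T_le.
have T1 : opnorm T = 1.
  apply/eqP; rewrite eq_le opnorm_le//=; have [j js] := turned_on_side.
  have vB : unit_ball X (vertex 0 false) := norm_vertex 0 false.
  apply: le_trans (le_opnorm_ball T _ bT vB).
  have := state_norm_le _ _ _ (side_state j false false) (T (vertex 0 false)).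
  have a0 : ang 0 = 0 by rewrite /vertex_angle mul0r.
  rewrite Tfc side_functionalE a0 sin0 cos0 expr0 mul1r.
  rewrite (_ : _ * _ + _ = cos delta); last by rewrite -js; ring.
  by rewrite divff ?normr1// gt_eqF ?(cos_half_step_gt0 n hn).
apply: (eta_dw_eq _ _ T) => //; first by rewrite mulr_ge0// ltW.
- move=> x f xf; have xB : unit_ball X x by rewrite /unit_ball/=; have [/= ->] := xf.
  (* Lumer's estimate is sharp at the step [t] with [t * c = tan delta]. *)
  have shift (b : bool) : `|x + ((-1) ^+ b * (tan delta / c)) *: T x|
      <= 1 + tan delta / c * (c * tan delta).
    have -> : 1 + tan delta / c * (c * tan delta) = 1 + tan delta ^+ 2.
      by field; rewrite gt_eqF.
    pose g : {linear X -> X} := idfun \+ ((-1) ^+ nat_of_bool b * (tan delta / c)) \*: T.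
    have gE z : g z = z + ((-1) ^+ b * (tan delta / c)) *: T z by [].
    rewrite -gE; move: x xB {xf}; apply: ball_le_vertices => k b' _.
    rewrite gE Tfc !frame_combZ frame_combD.
    have := norm_shifted_vertex k b' b; congr (`|fc _ _ _| <= _).
    + by field; rewrite gt_eqF.
    + by field; rewrite gt_eqF.
    + by ring.
  apply: (state_numerical_bound _ T (tan delta / c)) xf _ _ _.
  + by rewrite divr_gt0.
  + by have := shift false; rewrite expr0 mul1r.
  + by have := shift true; rewrite expr1 mulN1r scaleNr.
move=> S bS S1; have [k [b Sv]] := norm_attained_at_vertex S bS S1.
have [f [vf sf]] := vertex_state_ge k b _ Sv.
by exists (vertex k b), f.
Qed.

End QuarterTurn.

End Prism.

(** * From the right prism to its frame *)

Section Dot.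
Context {R : realType} {d : nat}.
Implicit Types u v w : 'rV[R]_d.

Lemma dotE u v : dot u v = \sum_i u 0 i * v 0 i.
Proof. by rewrite /dot mxE; apply: eq_bigr => i _; rewrite mxE. Qed.

Lemma dotC u v : dot u v = dot v u.
Proof. by rewrite !dotE; apply: eq_bigr => i _; rewrite mulrC. Qed.

Lemma dotDl u v w : dot (u + v) w = dot u w + dot v w.
Proof. by rewrite /dot mulmxDl mxE. Qed.

Lemma dotZl a u w : dot (a *: u) w = a * dot u w.
Proof. by rewrite /dot -scalemxAl mxE. Qed.

Lemma dot_gt0 w : w != 0 -> 0 < dot w w.
Proof.
move=> w0; rewrite lt_neqAle dotE sumr_ge0 ?andbT; last by move=> i _; exact: sqr_ge0.
apply: contraNneq w0 => /esym w2; apply/eqP/rowP => i; rewrite mxE.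
have sq0 (j : 'I_d) : true -> 0 <= w 0 j * w 0 j by rewrite -expr2 sqr_ge0.
have /eqP := @psumr_eq0P _ _ _ _ sq0 w2 i isT.
by rewrite mulf_eq0 orbb => /eqP.
Qed.

End Dot.

Section PrismGeometry.
Context {R : realType} (n : nat) (hn : (2 <= n)%N).
Context (c u v w : 'rV[R]_3) (r : R) (r0 : 0 < r).

Local Notation ang := (@vertex_angle R n).

Definition base_vertex k : 'rV[R]_3 :=
  c + r *: (cos (ang k) *: u + sin (ang k) *: v).

Let P := conv_hull (polygon_vertices (2 * n) c u v r).
Let Q := conv_hull (P `|` [set p + w | p in P]).

Lemma base_vertexP k : P (base_vertex k).
Proof.
apply: sub_conv_hull; exists (k %% (2 * n))%N.
  by rewrite /= ltn_mod muln_gt0; case: n hn.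
rewrite /base_vertex; have := cos_vertex_angle_mod (R := R) n hn k 0.
by have := sin_vertex_angle_mod (R := R) n hn k 0; rewrite !addr0 => <- <-.
Qed.

Lemma prism_vertexP k (b : bool) : Q (base_vertex k + b%:R *: w).
Proof.
apply: sub_conv_hull; case: b.
  by right; rewrite scale1r; exists (base_vertex k) => //; exact: base_vertexP.
by left; rewrite scale0r addr0; exact: base_vertexP.
Qed.

Lemma prism_sub (C : set 'rV[R]_3) : convex_set C ->
  (forall k (b : bool), (k < 2 * n)%N -> C (base_vertex k + b%:R *: w)) -> Q `<=` C.
Proof.
move=> cC Cv; apply: conv_hull_sub => // x [Px|[p Pp <-]].
  move: x Px; apply: conv_hull_sub => // _ [k /= kn <-].
  by have := Cv k false kn; rewrite scale0r addr0.
rewrite addrC; move: p Pp; apply: conv_hull_sub.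
  exact: (convex_preimage idfun w C).
by move=> _ [k /= kn <-]; have := Cv k true kn; rewrite scale1r addrC.
Qed.

Lemma base_vertex_opp k : base_vertex (k + n) = c + c - base_vertex k.
Proof.
rewrite /base_vertex vertex_angleD (vertex_angle_half n hn) cosDpi sinDpi.
by rewrite !scaleNr -opprD scalerN opprD addrA addrK.
Qed.

Lemma prism_reflect q : Q q -> Q (c + c + w - q).
Proof.
have cQ : convex_set Q := convex_conv_hull _.
move: q; apply: (prism_sub [set q | Q (c + c + w - q)]).
  exact: (convex_preimage -%R (c + c + w) Q cQ).
move=> k b _ /=.
have -> : c + c + w - (base_vertex k + b%:R *: w)
    = base_vertex (k + n) + (~~ b)%:R *: w.
  rewrite base_vertex_opp; move: (base_vertex k) => p.
  rewrite opprD addrACA; congr (_ + _).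
  by case: b; rewrite ?scale1r ?scale0r ?subrr ?subr0.
exact: prism_vertexP.
Qed.

Context (w_orth : forall p q, P p -> P q -> dot (q - p) w = 0).

Lemma base_orth : dot u w = 0 /\ dot v w = 0.
Proof.
have orth k : (cos (ang k) - 1) * dot u w + sin (ang k) * dot v w = 0.
  have := w_orth _ _ (base_vertexP 0) (base_vertexP k).
  have a0 : ang 0 = 0 by rewrite /vertex_angle mul0r.
  rewrite /base_vertex a0 cos0 sin0 scale1r scale0r addr0.
  rewrite opprD addrACA subrr add0r -scalerBr dotZl => /eqP.
  rewrite mulf_eq0 gt_eqF//= => /eqP <-.
  by rewrite -scaleN1r !dotDl !dotZl; ring.
(* [u] joins opposite vertices; the next vertex then gives [v] *)
have uw : dot u w = 0.
  have := orth n; rewrite (vertex_angle_half n hn) cospi sinpi; lra.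
split=> //; have /eqP := orth 1%N.
rewrite uw mulr0 add0r mulf_eq0 vertex_angle1 => /orP[|/eqP//].
rewrite gt_eqF// sin_gt0_pi//.
have := pi_gt0 R; have := half_step_gt0 n hn (R := R).
by have := half_step_le n hn (R := R); lra.
Qed.

End PrismGeometry.

(** A unit ball is symmetric, and so is a prism over a polygon with an even
    number of sides about its own centre; composing the two reflections gives a
    translation that preserves the ball, which must be trivial.  So the prism
    is centred at the origin. *)
Lemma prism_centre {R : realType} (n : nat) (hn : (2 <= n)%N)
    (X : normedModType R) (phi : {linear X -> 'rV[R]_3})
    (c u v w : 'rV[R]_3) (r : R) : bijective phi ->
  phi @` unit_ball X = conv_hull
    (conv_hull (polygon_vertices (2 * n) c u v r) `|`
     [set p + w | p in conv_hull (polygon_vertices (2 * n) c u v r)]) ->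
  c + c + w = 0.
Proof.
move=> [psi phiK psiK] ballE; set z := c + c + w.
have shift x : unit_ball X x -> unit_ball X (psi z + x).
  move=> xB; have : (phi @` unit_ball X) (phi (- x)).
    by exists (- x) => //; rewrite /unit_ball/= normrN.
  rewrite ballE => /(prism_reflect n hn c u v w r); rewrite -ballE -/z => -[y yB].
  by move=> yE; rewrite (_ : psi z + x = y)//; apply: (can_inj phiK);
     rewrite yE linearD psiK linearN opprK.
(* the ball would contain every multiple of the translation vector *)
have multiples N : unit_ball X (psi z *+ N).
  by elim: N => [|N /shift]; [rewrite mulr0n; exact: unit_ball0|rewrite mulrS].
suff z0 : psi z = 0 by rewrite -(psiK z) z0 linear0.
apply/eqP; apply: contraT; rewrite -normr_gt0 => z_gt0.
have := multiples (Num.bound (`|psi z|^-1)); rewrite /unit_ball/= normrMn.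
rewrite -mulr_natr leNgt -ltr_pdivrMl// mulr1.
by rewrite archi_boundP// invr_ge0.
Qed.

Lemma prism_frame_exists {R : realType} (n : nat) (hn : (2 <= n)%N)
    (X : normedModType R) (phi : {linear X -> 'rV[R]_3}) (P : set 'rV[R]_3) :
  bijective phi -> is_regular_polygon (2 * n) P ->
  is_right_prism P (phi @` unit_ball X) ->
  exists U V W al be ga, prism_frame X n U V W al be ga.
Proof.
move=> phi_bij [_ [c [u [v [r [r0 uu vv uv PE]]]]]] [w [w0 w_orth ballE]].
have ww := dot_gt0 w w0; have wn : dot w w != 0 by rewrite gt_eqF.
have rn : r != 0 by rewrite gt_eqF.
subst P; have [uw vw] := base_orth n hn c u v w r r0 w_orth.
have cw := prism_centre n hn X phi c u v w r phi_bij ballE.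
have cE : c = - 2^-1 *: w.
  have -> : w = - (c + c) by rewrite -[RHS](add0r) -cw; rewrite addrAC subrr add0r.
  by rewrite scaleNr scalerN opprK -mulr2n -[c *+ 2]scaler_nat scalerA mulVf ?scale1r ?pnatr_eq0.
have [psi phiK psiK] := phi_bij.
have coordinate (a : 'rV[R]_3) (k : R) :
    exists f : {linear X -> R^o}, forall x, f x = k * dot (phi x) a :> R.
  apply: linear_of => t x y; rewrite linearD linearZ dotDl dotZl /=.
  by rewrite -[_ *: _]/(_ * _); ring.
have [al alE] := coordinate u r^-1; have [be beE] := coordinate v r^-1.
have [ga gaE] := coordinate w (2 / dot w w).
pose U := psi (r *: u); pose V := psi (r *: v); pose W := psi (2^-1 *: w).
have phi_comb a b d : phi (frame_comb U V W a b d)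
    = r *: (a *: u + b *: v) + (d / 2) *: w.
  rewrite /frame_comb !linearD !linearZ /= !psiK ?scalerDr !scalerA.
  by rewrite (mulrC a) (mulrC b).
have coord a b d : [/\ al (frame_comb U V W a b d) = a,
    be (frame_comb U V W a b d) = b & ga (frame_comb U V W a b d) = d].
  rewrite alE beE gaE phi_comb !dotDl !dotZl !dotDl !dotZl.
  rewrite (dotC v u) (dotC w u) (dotC w v) uu vv uv uw vw.
  by split; field.
have vertexE k (b : bool) : frame_comb U V W (cos (vertex_angle n k))
    (sin (vertex_angle n k)) ((-1) ^+ b)
    = psi (base_vertex n c u v r k + (~~ b)%:R *: w).
  apply: (can_inj phiK); rewrite psiK phi_comb /base_vertex cE.
  rewrite [X in _ = X + _]addrC -addrA -scalerDl; congr (_ + _ *: _).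
  by case: b; rewrite /= ?expr0 ?expr1; field.
have psi_lin a x y : psi (a *: x + y) = a *: psi x + psi y.
  by apply: (can_inj phiK); rewrite linearP !psiK.
have hull (C : set X) : convex_set C ->
    (forall k (b : bool), (k < 2 * n)%N ->
      C (frame_comb U V W (cos (vertex_angle n k)) (sin (vertex_angle n k))
           ((-1) ^+ b))) ->
    unit_ball X `<=` C.
  move=> cC Cv x xB; rewrite -(phiK x).
  have [g gE] := linear_of _ _ psi psi_lin.
  have : (phi @` unit_ball X) (phi x) by exists x.
  rewrite ballE; move: (phi x) => {xB} q.
  apply: (prism_sub n c u v w r [set q | C (psi q)]).
    have := convex_preimage g 0 C cC; congr (convex_set _).
    by apply/funext => p /=; rewrite add0r gE.
  by move=> k b kn; have := Cv k (~~ b) kn; rewrite vertexE negbK.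
exists U, V, W, al, be, ga; split=> //.
- have comb_ball : unit_ball X `<=`
      [set x | x = frame_comb U V W (al x) (be x) (ga x)].
    apply: hull => [|k b _] /=.
      apply/convex_setP => x y t _ _ /= xE yE.
      rewrite {1}xE {1}yE !frame_combZ frame_combD.
      by rewrite !linearD !linearZ.
    by have [-> -> ->] := coord (cos (vertex_angle n k))
      (sin (vertex_angle n k)) ((-1) ^+ b).
  move=> x; have [->|x0] := eqVneq x 0.
    by rewrite !linear0 /frame_comb !scale0r !addr0.
  have x_gt0 : 0 < `|x| by rewrite normr_gt0.
  have := comb_ball (`|x|^-1 *: x).
  rewrite /unit_ball/= normrZ normfV normr_id mulVf ?gt_eqF// => /(_ (lexx _)).
  rewrite !linearZ => xE; apply: (@scalerI _ _ `|x|^-1).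
    by rewrite invr_eq0 gt_eqF.
  by rewrite frame_combZ; exact: xE.
- move=> k b _; rewrite vertexE.
  have : (phi @` unit_ball X) (base_vertex n c u v r k + (~~ b)%:R *: w).
    by rewrite ballE; exact: prism_vertexP.
  by move=> [x xB <-]; rewrite phiK.
Qed.

Theorem theorem3p7 (R : realType) (n : nat) (X : completeNormedModType R)
    (phi : {linear X -> 'rV[R]_3})
    (hn : (2 <= n)%N)
    (phi_bij : bijective phi)
    (X_polyhedral : polyhedral X)
    (B_prism : exists P : set 'rV[R]_3,
       is_regular_polygon (2 * n) P /\
       is_right_prism P (phi @` unit_ball X)) :
  eta_dw X =
    if odd n then Num.sqrt (sin (pi / (2 * n)%:R) ^+ 2 + 1)
    else Num.sqrt (tan (pi / (2 * n)%:R) ^+ 2 + 1).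
Proof.
have [P [Ppoly Pprism]] := B_prism.
have [U [V [W [al [be [ga frame]]]]]] :=
  prism_frame_exists n hn X phi P phi_bij Ppoly Pprism.
rewrite -/(half_step n); set delta := half_step n.
have vertex1 := norm_vertex X n hn U V W al be ga frame.
have cos_gt0 : 0 < cos delta := cos_half_step_gt0 n hn.
have nd : n%:R * delta = pi / 2 := n_half_step n hn.
(* For odd [n], [n./2] steps and a half make a quarter turn, so a turned vertex
   points to the midpoint of the side between two consecutive vertices. *)
have := odd_double_half n; case: (odd n) => halfE; last first.
  have quarter : vertex_angle n n./2 = pi / 2 :> R.
    rewrite vertex_angleE -nd -[in RHS]halfE add0n -mul2n natrM /delta; ring.
  rewrite -[tan _]mul1r.
  apply: (eta_dw_prism X n hn U V W al be ga frame 1) => //.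
  - move=> k b; have := vertex1 (k + n./2)%N b.
    by rewrite vertex_angleD quarter cosDpihalf sinDpihalf !mul1r.
  - by exists n./2; rewrite mul1r addrC quarter sinDpihalf.
have quarter : vertex_angle n n./2 + delta = pi / 2 :> R.
  have nE : n%:R = 1 + 2 * n./2%:R :> R.
    by rewrite -[in LHS]halfE natrD -mul2n natrM.
  by rewrite vertex_angleE -nd nE /delta; ring.
have -> : sin delta = cos delta * tan delta.
  by rewrite /tan mulrC divfK// gt_eqF.
apply: (eta_dw_prism X n hn U V W al be ga frame (cos delta)) => //.
- move=> k b.
  have halves e : vertex_angle n (k + n./2 + e)
      = vertex_angle n k + pi / 2 + (e%:R * 2 - 1) * delta :> R.
    rewrite !vertex_angleD -quarter [X in _ + X = _]vertex_angleE /delta; ring.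
  have -> : frame_comb U V W (- (cos delta * sin (vertex_angle n k)))
      (cos delta * cos (vertex_angle n k)) ((-1) ^+ b)
    = 2^-1 *: frame_comb U V W (cos (vertex_angle n (k + n./2 + 0)))
        (sin (vertex_angle n (k + n./2 + 0))) ((-1) ^+ b)
    + 2^-1 *: frame_comb U V W (cos (vertex_angle n (k + n./2 + 1)))
        (sin (vertex_angle n (k + n./2 + 1))) ((-1) ^+ b).
    rewrite !frame_combZ frame_combD !halves mul0r sub0r mulN1r mul1r.
    rewrite (_ : 2 - 1 = 1) ?mul1r; last by ring.
    rewrite !(cosD, sinD, cosN, sinN) cos_pihalf sin_pihalf.
    by move: ((-1) ^+ b) => h; congr frame_comb; field.
  rewrite (le_trans (ler_norm_comb _ _ _ _))// ger0_norm ?invr_ge0//.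
  have := vertex1 (k + n./2 + 0)%N b; have := vertex1 (k + n./2 + 1)%N b; lra.
- by exists n./2; rewrite quarter sin_pihalf mulr1.
Qed.
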